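(* Let $G$ be a partially ordered group with identity $e$ and positive cone $G^+ = \{x \in G : x > e\}$. Let $H^+$ be the set of all atoms of $G^+$, i.e. the elements $x \in G^+$ such that there is no $y \in G$ with $e < y < x$. Let $\mathcal{J}$ be a set of nonempty finite subsets of $G^+$ such that the open interval $(e,x) = \{y\in G: e<y<x\}$ belongs to $\mathcal{J}$ for every $x \in G^+ \setminus H^+$. For $A \subseteq G$ let $\sigma_{\mathcal{J}}(A) = \inf\{ |A\cap J|/|J| : J \in \mathcal{J}\}$. Let $A$ and $B$ be subsets of $G^+$ with $H^+ \subseteq A \cup B$. If $\sigma_{\mathcal{J}}(A) + \sigma_{\mathcal{J}}(B) > 1$, then $AB = G^+ \cup \{e\}$, where $AB = \{ab : a \in A\cup\{e\},\ b \in B \cup \{e\}\}$.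
   Context: A partially ordered group is a group $G$ with a partial order $\le$ such that $a \le b$ implies $ac \le bc$ and $ca \le cb$ for all $a,b,c \in G$. We write $x<y$ if $x \le y$ and $x \ne y$. *)

(* Defs.v *)
From HB Require Import structures.
From mathcomp Require Import all_boot all_order all_algebra finmap.
From mathcomp Require Import boolp classical_sets functions cardinality.
From mathcomp Require Import reals constructive_ereal ereal.

Set Implicit Arguments.
Unset Strict Implicit.
Unset Printing Implicit Defensive.

Import Order.TTheory.

Local Open Scope group_scope.
Local Open Scope order_scope.
Local Open Scope classical_set_scope.

HB.mixin Record Group_POrder_isPOGroup (d : Order.disp_t) G
    of Group G & Order.POrder d G := {
  lepg_mul2r : forall a b c : G, a <= b -> (a * c)%g <= (b * c)%g;
  lepg_mul2l : forall a b c : G, a <= b -> (c * a)%g <= (c * b)%g }.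

#[short(type="poGroupType")]
HB.structure Definition POGroup (d : Order.disp_t) :=
  { G of Group_POrder_isPOGroup d G & Group G & Order.POrder d G }.

Section PartiallyOrderedGroup.
Variables (d : Order.disp_t) (G : poGroupType d).
Implicit Types (A B X : set G) (J : set (set G)).

Definition pos_cone : set G := [set x | 1%g < x].

Definition open_itv1 (x : G) : set G := [set y | 1%g < y < x].

Definition atoms : set G := [set x | pos_cone x /\ ~ exists y, open_itv1 x y].

Definition prod1 A B : set G :=
  [set (a * b)%g | a in A `|` [set 1%g] & b in B `|` [set 1%g]].

(* The infimum is taken in the extended reals, so it is +oo when J is empty.
   If J contains all intervals (e, x) with x a positive non-atom, then J is
   empty only when every positive element is an atom. *)
Definition sigma (R : realType) J A : \bar R :=
  ereal_inf [set ((#|` fset_set (A `&` X)|%:R / #|` fset_set X|%:R)%R)%:E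
            | X in J].

End PartiallyOrderedGroup.

Arguments pos_cone {d} G.
Arguments atoms {d} G.

(* Main.v *)
(** If [x] is positive and not an atom, [y |-> y^-1 x] maps the finite interval
    [I = (e, x)] injectively into itself. The density hypothesis gives
    [|A `&` I| + |B `&` I| > |I|], so by the pigeonhole principle [a^-1 x] lies
    in [B] for some [a] in [A `&` I], that is [x = a b]. *)

Require Import Defs.
From mathcomp Require Import all_boot all_order all_algebra finmap.
From mathcomp Require Import boolp classical_sets functions cardinality.
From mathcomp Require Import reals constructive_ereal ereal.

Local Open Scope classical_set_scope.

Section POGroupTheory.
Variables (d : Order.disp_t) (G : poGroupType d).
Implicit Types x y z : G.

Lemma ltg_mul2l z x y : (x < y)%O -> ((z * x)%g < (z * y)%g)%O.
Proof.
rewrite !Order.POrderTheory.lt_def => /andP[yx xy].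
by rewrite lepg_mul2l// andbT (inj_eq (mulgI z)).
Qed.

Lemma ltg_mul2r z x y : (x < y)%O -> ((x * z)%g < (y * z)%g)%O.
Proof.
rewrite !Order.POrderTheory.lt_def => /andP[yx xy].
by rewrite lepg_mul2r// andbT (inj_eq (mulIg z)).
Qed.

(** Left multiplication of [y < x] by [y^-1] gives the lower bound; right multiplication of [1 < y]
    by [y^-1 * x] gives the upper one. *)
Lemma open_itv1_div x y : open_itv1 x y -> open_itv1 x (y^-1 * x)%g.
Proof.
move=> /= /andP[y_gt1 ltyx]; apply/andP; split.
  by have := ltg_mul2l y^-1%g _ _ ltyx; rewrite mulVg.
by have := ltg_mul2r (y^-1 * x)%g _ _ y_gt1; rewrite mul1g mulVKg.
Qed.

Lemma pos_coneM x y : pos_cone G x -> pos_cone G y -> pos_cone G (x * y)%g.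
Proof.
move=> x_gt1 y_gt1; apply: (Order.POrderTheory.lt_trans x_gt1).
by have := ltg_mul2l x _ _ y_gt1; rewrite mulg1.
Qed.

Lemma prod1_sub_pos_cone (A B : set G) :
  A `<=` pos_cone G -> B `<=` pos_cone G ->
  prod1 A B `<=` pos_cone G `|` [set 1%g].
Proof.
move=> hA hB _ [a [/hA a_gt1|->] [b [/hB b_gt1|->] <-]];
  rewrite ?mul1g ?mulg1; [left|by left|by left|by right].
exact: pos_coneM.
Qed.

End POGroupTheory.

(** Otherwise the image of [X], which has as many elements as [X] by injectivity, and [Y] would be
    disjoint subsets of [I], too large to fit together. *)
Lemma fset_pigeonhole (T : choiceType) (f : T -> T) (X Y I : {fset T}) :
  injective f -> (forall y, y \in X -> f y \in I) -> (Y `<=` I)%fset ->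
  (#|` I| < #|` X| + #|` Y|)%N -> exists2 y, y \in X & f y \in Y.
Proof.
move=> f_inj fXI YI ltI; apply: contrapT => noy.
have disj : [disjoint (f @` X)%fset & Y]%fset.
  apply/fdisjointP => _ /imfsetP[y /= yX ->]; apply/negP => fyY.
  by apply: noy; exists y.
have /fsubset_leq_card : ((f @` X) `|` Y `<=` I)%fset.
  rewrite fsubUset YI andbT; apply/fsubsetP => _ /imfsetP[y /= yX ->].
  exact: fXI.
have := cardfsUI (f @` X)%fset Y.
rewrite (eqP disj) cardfs0 addn0 => ->.
by rewrite card_imfset//= leqNgt ltI.
Qed.

(** Each infimum is at most the ratio at [X], so the two ratios at [X] add up to more than 1; it
    remains to clear the common denominator. *)
Lemma sigma_gt1_card (R : realType) (d : Order.disp_t) (G : poGroupType d)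
    (J : set (set G)) (A B X : set G) :
  J X -> X !=set0 -> finite_set X ->
  (1%:E < sigma R J A + sigma R J B)%E ->
  (#|` fset_set X| < #|` fset_set (A `&` X)| + #|` fset_set (B `&` X)|)%N.
Proof.
move=> JX [x Xx] finX sAB.
(* Finiteness matters here: [fset_set] sends an infinite set to the empty one. *)
have card_gt0 : (0 < #|` fset_set X|%:R :> R)%R.
  by rewrite Num.Theory.ltr0n cardfs_gt0; apply/fset0Pn; exists x;
     rewrite in_fset_set// inE.
have sle C : (sigma R J C <=
    (#|` fset_set (C `&` X)|%:R / #|` fset_set X|%:R)%R%:E)%E.
  by apply: ereal_inf_lbound; exists X.
have := Order.POrderTheory.lt_le_trans sAB (leeD (sle A) (sle B)).
rewrite -EFinD lte_fin -GRing.mulrDl Num.Theory.ltr_pdivlMr//.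
by rewrite GRing.mul1r -GRing.natrD Num.Theory.ltr_nat.
Qed.

Theorem theorem2p3 (R : realType) (d : Order.disp_t) (G : poGroupType d)
    (J : set (set G))
    (hJ : forall X : set G, J X ->
      [/\ X !=set0, finite_set X & X `<=` pos_cone G])
    (hJitv : forall x : G, (pos_cone G `\` atoms G) x -> J (open_itv1 x))
    (A B : set G)
    (hA : A `<=` pos_cone G) (hB : B `<=` pos_cone G)
    (hAB : atoms G `<=` A `|` B)
    (hsigma : (1%:E < sigma R J A + sigma R J B)%E) :
  prod1 A B = pos_cone G `|` [set 1%g].
Proof.
apply/seteqP; split; first exact: prod1_sub_pos_cone.
move=> x [x_gt1|->]; last first.
  by exists 1%g; [right|exists 1%g; [right|rewrite mulg1]].
(* An atom already lies in [A] or [B], so the other factor can be 1. *)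
have [/hAB[Ax|Bx]|xNatom] := pselect (atoms G x).
- by exists x; [left|exists 1%g; [right|rewrite mulg1]].
- by exists 1%g; [right|exists x; [left|rewrite mul1g]].
have JI : J (open_itv1 x) by exact: hJitv.
have [I0 finI _] := hJ _ JI.
have finAI C : finite_set (C `&` open_itv1 x) by exact: finite_setIr.
have f_inj : injective (fun y : G => y^-1 * x)%g.
  by move=> y z /mulIg /invg_inj.
(* The three finite sets are the traces of [A] and [B] on the interval [open_itv1 x], and that
   interval itself. *)
have [||y] := fset_pigeonhole _ _ _ _ _ f_inj _ _
  (sigma_gt1_card _ _ _ _ _ _ _ JI I0 finI hsigma).
- move=> y; rewrite !in_fset_set// !inE => -[_ Iy].
  exact: open_itv1_div.
- by rewrite -fset_set_sub//; exact: subIsetr.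
rewrite !in_fset_set// !inE => -[Ay _] [By _].
by exists y; [left|exists (y^-1 * x)%g; [left|rewrite mulVKg]].
Qed.
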